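(* Let $\Omega\subset\mathbb R^d$ be a domain with smooth boundary $\partial\Omega$ and unit normal $\bm n$, let $\bm\alpha_1,\dots,\bm\alpha_m$ be $m$ volatility modes (vector fields on $\overline\Omega$), and let $\bm a=\sum_{r=1}^m\bm\alpha_r\otimes\bm\alpha_r$. If every mode is tangent to the boundary, $\bm\alpha_r\cdot\bm n=0$ on $\partial\Omega$ for $r=1,\dots,m$, then on $\partial\Omega$ $$\bm a\bm n=0,\qquad \operatorname{rank}(\bm a|_{\partial\Omega})\le d-1 .$$ The condition limits the range of the covariance, not the number $m$ of Brownian modes ($m$ is arbitrary).
   Context: $\bm a(\bm x)$ is the $d\times d$ displacement covariance matrix at $\bm x$ generated by $m$ stochastic channels $\sum_r\bm\alpha_r\,\mathrm dW_t^r$; the rank statement is pointwise on $\partial\Omega$. *)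

(* Defs.v *)
From mathcomp Require Import all_boot all_order all_algebra.
From mathcomp Require Import all_classical all_reals all_analysis.
Export numFieldNormedType.Exports.

Set Implicit Arguments.
Unset Strict Implicit.
Unset Printing Implicit Defensive.

Import Order.TTheory GRing.Theory Num.Theory.

Local Open Scope classical_set_scope.
Local Open Scope ring_scope.

(* The norm `|_| that MathComp-Analysis puts on matrices is the max norm, so
   Euclidean orthogonality and unit length are expressed through [dot]. *)
Definition dot (R : realType) (d : nat) (u v : 'cV[R]_d) : R :=
  \sum_(i < d) u i 0 * v i 0.

Definition outer (R : realType) (d : nat) (u v : 'cV[R]_d) : 'M[R]_d :=
  u *m v^T.

Definition partial (R : realType) (d : nat) (i : 'I_d) (f : 'cV[R]_d -> R) :
  'cV[R]_d -> R := 'D_(delta_mx i 0) f.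

Definition gradient (R : realType) (d : nat) (f : 'cV[R]_d -> R)
  (x : 'cV[R]_d) : 'cV[R]_d := \col_i partial i f x.

(* C^infinity on an open set U: the iterated partial derivatives of every order
   exist and are continuous at every point of U. *)
Definition smooth_on (R : realType) (d : nat) (U : set 'cV[R]_d)
    (f : 'cV[R]_d -> R) : Prop :=
  forall (s : seq 'I_d) (x : 'cV[R]_d), U x ->
    {for x, continuous (foldr (@partial R d) f s)} /\
    forall i : 'I_d, derivable (foldr (@partial R d) f s) x (delta_mx i 0).

Definition boundary (R : realType) (d : nat) (Omega : set 'cV[R]_d) :
  set 'cV[R]_d := closure Omega `\` interior Omega.

Definition domain (R : realType) (d : nat) (Omega : set 'cV[R]_d) : Prop :=
  [/\ open Omega, connected Omega & Omega !=set0].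

(* Near x, Omega is the sublevel set {phi < 0} of a smooth phi with
   nonvanishing gradient; by the implicit function theorem the boundary near x
   is then the smooth hypersurface {phi = 0}, with Omega on one side of it. *)
Definition local_defining_function (R : realType) (d : nat)
    (Omega : set 'cV[R]_d) (x : 'cV[R]_d) (phi : 'cV[R]_d -> R) : Prop :=
  exists U : set 'cV[R]_d,
    [/\ open_nbhs x U, smooth_on U phi,
        forall y, U y -> gradient phi y != 0 &
        forall y, U y -> (Omega y <-> phi y < 0)].

Definition smooth_boundary (R : realType) (d : nat) (Omega : set 'cV[R]_d) :
    Prop :=
  forall x, boundary Omega x ->
    exists phi : 'cV[R]_d -> R, local_defining_function Omega x phi.

(* The normal line at x is spanned by the gradient of a local defining function.
   The orientation of n is left free: the outward and the inward unit normal
   fields both satisfy this. *)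
Definition unit_normal (R : realType) (d : nat) (Omega : set 'cV[R]_d)
    (n : 'cV[R]_d -> 'cV[R]_d) : Prop :=
  forall x, boundary Omega x ->
    dot (n x) (n x) = 1 /\
    exists (phi : 'cV[R]_d -> R) (c : R),
      local_defining_function Omega x phi /\ n x = c *: gradient phi x.

Definition mode_covariance (R : realType) (d m : nat)
    (alpha : 'I_m -> 'cV[R]_d -> 'cV[R]_d) (x : 'cV[R]_d) : 'M[R]_d :=
  \sum_(r < m) outer (alpha r x) (alpha r x).

(* Main.v *)
Require Import Defs.
From mathcomp Require Import all_boot all_order all_algebra.
From mathcomp Require Import all_classical all_reals all_analysis.

Import GRing.Theory.

Local Open Scope classical_set_scope.
Local Open Scope ring_scope.

(** Each term of the covariance sends the normal to a multiple of its mode, with factor the normal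
    component of that mode ([outer_mulmx]). Tangency makes every factor zero, so the sum kills [n x]
    whatever [m] is. A unit normal is nonzero, hence the kernel is nontrivial and the rank drops
    ([rank_le_pred_of_ker]). *)

Lemma outer_mulmx (R : realType) (d : nat) (u v w : 'cV[R]_d) :
  outer u v *m w = dot v w *: u.
Proof.
have vw : v^T *m w = (dot v w)%:M.
  rewrite [LHS]mx11_scalar mxE; congr _%:M.
  by apply: eq_bigr => i _; rewrite mxE.
by rewrite /outer -mulmxA vw mul_mx_scalar.
Qed.

Lemma dot0l (R : realType) (d : nat) (v : 'cV[R]_d) : dot 0 v = 0.
Proof. by rewrite /dot big1 // => i _; rewrite mxE mul0r. Qed.

(** Since [A *m v = 0], the ranks of [A] and [v] add up to at most [d], and a nonzero column has
    positive rank. *)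
Lemma rank_le_pred_of_ker (F : fieldType) (p d : nat) (A : 'M[F]_(p, d))
    (v : 'cV[F]_d) :
  v != 0 -> A *m v = 0 -> (\rank A <= d.-1)%N.
Proof.
rewrite -mxrank_eq0 -lt0n => v_gt0 /mulmx0_rank_max rank_sum.
have : (\rank A < d)%N.
  by apply: leq_trans rank_sum; rewrite -addn1 leq_add2l.
(* The strict bound also forces [d] to be positive, so [d.-1.+1] is [d]. *)
by move=> rank_lt; rewrite -ltnS (ltn_predK rank_lt).
Qed.

Theorem lemma8p1 (R : realType) (d m : nat) (Omega : set 'cV[R]_d)
    (n : 'cV[R]_d -> 'cV[R]_d) (alpha : 'I_m -> 'cV[R]_d -> 'cV[R]_d)
    (Omega_domain : domain Omega) (Omega_smooth : smooth_boundary Omega)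
    (n_normal : unit_normal Omega n)
    (alpha_tangent : forall (r : 'I_m) (x : 'cV[R]_d),
        boundary Omega x -> dot (alpha r x) (n x) = 0) :
  forall x : 'cV[R]_d, boundary Omega x ->
    mode_covariance alpha x *m n x = 0 /\
    (\rank (mode_covariance alpha x) <= d.-1)%N.
Proof.
move=> x bdx.
have an0 : mode_covariance alpha x *m n x = 0.
  rewrite mulmx_suml big1 // => r _.
  by rewrite outer_mulmx alpha_tangent // scale0r.
split=> //; apply: rank_le_pred_of_ker an0.
have [nn1 _] := n_normal x bdx.
(* If [n x] were zero, its square length would be 0 instead of 1. *)
by apply: contra_eq_neq nn1 => ->; rewrite dot0l eq_sym oner_neq0.
Qed.
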